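(* Let $\gamma>0$ be a target SINR, $Q_{\max}>0$ a maximum transmit power, and let $\mathrm{SINR}_{kl,\mathrm{dec}}(\mathbf q)$ be the optimal decentralized-LSFD SINR function of the transmit power vector $\mathbf q=(q_{kl})_{1\le k\le K,1\le l\le L}$ defined in the context (with either the matched filtering or the zero-forcing choice of $\lambda_{jk}$). Starting from any initial power vector $\mathbf q^{(0)}$ with $0<q^{(0)}_{kl}\le Q_{\max}$ for all $k,l$, consider the power update iteration, for $n\ge1$ and all $k,l$, $$q_{kl}^{(n)}=\begin{cases}q_{kl}^{(n-1)}\dfrac{\gamma}{\mathrm{SINR}_{kl}^{(n-1)}}, & \text{if }\dfrac{q_{kl}^{(n-1)}}{\mathrm{SINR}_{kl}^{(n-1)}}\le\dfrac{Q_{\max}}{\gamma},\\[3mm] \dfrac{Q_{\max}^2}{\gamma}\,\dfrac{\mathrm{SINR}_{kl}^{(n-1)}}{q_{kl}^{(n-1)}}, & \text{if }\dfrac{q_{kl}^{(n-1)}}{\mathrm{SINR}_{kl}^{(n-1)}}>\dfrac{Q_{\max}}{\gamma},\end{cases}$$ where $\mathrm{SINR}_{kl}^{(n-1)}=\mathrm{SINR}_{kl,\mathrm{dec}}(\mathbf q^{(n-1)})$. Then the sequence $\mathbf q^{(n)}$ always converges. Moreover, if the optimization problem $$\min_{\mathbf q}\ \sum_{k=1}^K\sum_{l=1}^Lq_{kl}\quad\text{subject to}\quad 0\le q_{kl}\le Q_{\max}\ \text{ and }\ \mathrm{SINR}_{kl,\mathrm{dec}}(\mathbf q)\ge\gamma\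 \text{ for all }k=1,\ldots,K,\ l=1,\ldots,L$$ is feasible, then $\mathbf q^{(n)}$ converges to the optimal powers $q_{kl}$ of this problem.
   Context: There are $L$ cells, each with a base station having $M$ antennas and $K$ single-antenna users. $\beta_{jkn}>0$ is the large scale fading coefficient between user $k$ of cell $n$ and base station $j$; $p_{kn}>0$ are fixed training powers; $q_{kn}$ are the data transmit powers. For each $l$, $\Omega^{(l)}\subseteq\{1,\ldots,L\}$ consists of $l$ and the indices of the $L'$ neighboring cells of cell $l$. Let $\boldsymbol\beta^{(l)}_{kn}=(\beta_{jkn}:j\in\Omega^{(l)})^T$ and $\boldsymbol\Lambda^{(l)}_k(\mathbf q)=\mathrm{diag}(\lambda_{jk}(\mathbf q):j\in\Omega^{(l)})$, where for matched filtering $M$-dimensional decoding $$\lambda_{jk}(\mathbf q)=\Bigl(1+\sum_{i=1}^L\beta_{jki}p_{ki}\Bigr)\Bigl(1+\sum_{n=1}^L\sum_{m=1}^K\beta_{jmn}q_{mn}\Bigr),$$ and for zero-forcing $M$-dimensional decoding (with $M>K$) $$\lambda_{jk}(\mathbf q)=\frac{M}{M-K}\Bigl(1+\sum_{i=1}^L\beta_{jki}p_{ki}\Bigr)\Bigl(1+\sum_{n=1}^L\sum_{m=1}^K\Bigl[\beta_{jmn}-\frac{\beta_{jmn}^2p_{mn}}{1+\sum_{i=1}^L\beta_{jmi}p_{mi}}\Bigr]q_{mn}\Bigr).$$ In the decentralized LSFD (Large Scale Fading Decoding) algorithm with transmit power optimization, in each iteration each base station uses the optimal (MMSE) decentralized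 LSFD coefficients for the current powers, so that the SINR of user $k$ of cell $l$ is $$\mathrm{SINR}_{kl,\mathrm{dec}}(\mathbf q)=p_{kl}q_{kl}M\cdot\boldsymbol\beta_{kl}^{(l)\mathsf H}\Bigl(\sum_{n=1,\,n\ne l}^L\boldsymbol\beta^{(l)}_{kn}\boldsymbol\beta^{(l)\mathsf H}_{kn}p_{kn}q_{kn}M+\boldsymbol\Lambda^{(l)}_k(\mathbf q)\Bigr)^{-1}\boldsymbol\beta^{(l)}_{kl},$$ and each user then updates its power by the stated rule. *)

(* Defs.v *)
From mathcomp Require Import all_boot all_order all_algebra.
From mathcomp Require Import all_classical all_reals all_analysis.

Set Implicit Arguments.
Unset Strict Implicit.
Unset Printing Implicit Defensive.

Import Order.TTheory GRing.Theory Num.Theory.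
Import numFieldNormedType.Exports.

Local Open Scope ring_scope.

Inductive decoding := MatchedFiltering | ZeroForcing.

Section DecentralizedLSFD.

(* [beta j k n] is the coefficient between user [k] of cell [n] and base
   station [j].  Power vectors (q_kl) are K x L matrices.  As all the data are
   real, the Hermitian transpose is the transpose. *)
Variables (R : realType) (L K M : nat).
Variable beta : 'I_L -> 'I_K -> 'I_L -> R.
Variable p : 'M[R]_(K, L).
Variable Omega : 'I_L -> {set 'I_L}.
Variable d : decoding.

Definition lambda_mf (q : 'M[R]_(K, L)) (j : 'I_L) (k : 'I_K) : R :=
  (1 + \sum_(i < L) beta j k i * p k i) *
  (1 + \sum_(n < L) \sum_(m < K) beta j m n * q m n).

Definition lambda_zf (q : 'M[R]_(K, L)) (j : 'I_L) (k : 'I_K) : R :=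
  M%:R / (M%:R - K%:R) *
  (1 + \sum_(i < L) beta j k i * p k i) *
  (1 + \sum_(n < L) \sum_(m < K)
     (beta j m n -
      beta j m n ^+ 2 * p m n / (1 + \sum_(i < L) beta j m i * p m i)) *
     q m n).

Definition lambda (q : 'M[R]_(K, L)) (j : 'I_L) (k : 'I_K) : R :=
  match d with
  | MatchedFiltering => lambda_mf q j k
  | ZeroForcing => lambda_zf q j k
  end.

(* Vectors and matrices indexed by the cells of [Omega l] are indexed by
   ['I_#|Omega l|] through the enumeration of [Omega l]. *)
Definition beta_vec (l : 'I_L) (k : 'I_K) (n : 'I_L) : 'cV[R]_#|Omega l| :=
  \col_(i < #|Omega l|) beta (enum_val i) k n.

Definition Lambda_mx (l : 'I_L) (k : 'I_K) (q : 'M[R]_(K, L)) :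
    'M[R]_#|Omega l| :=
  diag_mx (\row_(i < #|Omega l|) lambda q (enum_val i) k).

Definition interference_mx (k : 'I_K) (l : 'I_L) (q : 'M[R]_(K, L)) :
    'M[R]_#|Omega l| :=
  \sum_(n < L | n != l)
     (p k n * q k n * M%:R) *: (beta_vec l k n *m (beta_vec l k n)^T)
  + Lambda_mx l k q.

(* For positive [beta] and [p] and nonnegative [q] (and [K < M] under zero
   forcing), [interference_mx] is positive definite, so [invmx] is a genuine
   inverse. *)
Definition SINR_dec (k : 'I_K) (l : 'I_L) (q : 'M[R]_(K, L)) : R :=
  p k l * q k l * M%:R *
  ((beta_vec l k l)^T *m invmx (interference_mx k l q) *m beta_vec l k l) 0 0.

Variables gamma Qmax : R.

Definition power_update (q : 'M[R]_(K, L)) : 'M[R]_(K, L) :=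
  \matrix_(k < K, l < L)
    if q k l / SINR_dec k l q <= Qmax / gamma
    then q k l * (gamma / SINR_dec k l q)
    else Qmax ^+ 2 / gamma * (SINR_dec k l q / q k l).

Definition power_seq (q0 : 'M[R]_(K, L)) (n : nat) : 'M[R]_(K, L) :=
  iter n power_update q0.

Definition feasible_power (q : 'M[R]_(K, L)) : Prop :=
  forall (k : 'I_K) (l : 'I_L),
    0 <= q k l <= Qmax /\ gamma <= SINR_dec k l q.

Definition total_power (q : 'M[R]_(K, L)) : R :=
  \sum_(k < K) \sum_(l < L) q k l.

Definition optimal_power (q : 'M[R]_(K, L)) : Prop :=
  feasible_power q /\
  forall q' : 'M[R]_(K, L), feasible_power q' -> total_power q <= total_power q'.

End DecentralizedLSFD.

(* Main.v *)
(* Each user's update depends on the power I(q) it needs to reach the target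
   gamma against the current interference; with t = I(q), the new power is
   t if t <= Qmax and Qmax^2 / t otherwise.  Since
     1 / (b^T A^-1 b) = min { w^T A w : w^T b = 1 }
   and the interference matrix is affine in q, I is a minimum of affine
   functions of q with nonnegative coefficients.  Evaluating them at the
   minimizer w for y, x <= (1 + e) y gives
     I(x) <= (1 + e) I(y) - e I(0) <= (1 + z e) I(y)
   with a uniform z < 1 on 0 < q <= Qmax.  The capped update inherits this
   contraction of ratios, so the iterates converge geometrically to a fixed
   point.  At the user where the ratio of a fixed point to a feasible vector is
   largest, the first inequality shows that this ratio is at most 1: the fixed
   point lies entrywise below every feasible vector, and is then feasible. *)

Require Import Defs.
From mathcomp Require Import all_boot all_order all_algebra.
From mathcomp Require Import all_classical all_reals all_analysis.
From mathcomp Require Import ring lra.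

Set Implicit Arguments.
Unset Strict Implicit.
Unset Printing Implicit Defensive.

Import Order.TTheory GRing.Theory Num.Theory.
Import numFieldNormedType.Exports.

Local Open Scope classical_set_scope.
Local Open Scope ring_scope.

(** * Variational formula for [b^T A^-1 b] with [A] positive definite *)

Section PositiveDefinite.
Variables (R : realFieldType) (n : nat) (A : 'M[R]_n).
Hypothesis A_sym : A^T = A.
Hypothesis A_posdef : forall w : 'cV[R]_n, w != 0 -> 0 < (w^T *m A *m w) 0 0.

Lemma posdef_unitmx : A \in unitmx.
Proof.
rewrite -row_free_unit -kermx_eq0; apply/rowV0P => v /sub_kermxP vA0.
apply/eqP/contraT => v0; have : v^T != 0 by rewrite trmx_eq0.
by move=> /A_posdef; rewrite trmxK vA0 mul0mx mxE ltxx.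
Qed.

Lemma trmx_invmx_sym : (invmx A)^T = invmx A.
Proof. by rewrite trmx_inv A_sym. Qed.

Variable b : 'cV[R]_n.

Lemma scaled_invmxT c : (c *: (invmx A *m b))^T = c *: (b^T *m invmx A).
Proof.
rewrite -[in RHS]trmx_invmx_sym -trmx_mul.
by apply/matrixP => i j; rewrite !mxE.
Qed.

Lemma posdef_invmx_gt0 : b != 0 -> 0 < (b^T *m invmx A *m b) 0 0.
Proof.
move=> b0; have Au := posdef_unitmx.
have v0 : invmx A *m b != 0.
  by apply: contra b0 => /eqP v0; rewrite -(mulKVmx Au b) v0 mulmx0.
have := A_posdef v0.
by rewrite trmx_mul trmx_invmx_sym -!mulmxA mulKVmx // mulmxA.
Qed.

(** The minimizer is [A^-1 b] rescaled to unit gain on [b]. *)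
Lemma posdef_quad_attained : b != 0 ->
  exists2 w : 'cV[R]_n, (w^T *m b) 0 0 = 1 &
    (w^T *m A *m w) 0 0 = ((b^T *m invmx A *m b) 0 0)^-1.
Proof.
move=> b0; have Au := posdef_unitmx; have h0 := posdef_invmx_gt0 b0.
set h := (_ *m b) 0 0 in h0 *.
exists (h^-1 *: (invmx A *m b)).
  by rewrite scaled_invmxT -scalemxAl mxE -/h mulVf ?gt_eqF.
rewrite scaled_invmxT -!scalemxAl -scalemxAr.
rewrite -!mulmxA mulKVmx // mulmxA mxE [X in _ * X]mxE -/h.
by rewrite mulVf ?gt_eqF ?mulr1.
Qed.

(** Completing the square: the quadratic form of [A] at [w - h^-1 A^-1 b] is nonnegative and expands
    to [w^T A w - h^-1]. *)
Lemma posdef_quad_ge (w : 'cV[R]_n) : b != 0 -> (w^T *m b) 0 0 = 1 ->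
  ((b^T *m invmx A *m b) 0 0)^-1 <= (w^T *m A *m w) 0 0.
Proof.
move=> b0 wb; have Au := posdef_unitmx; have h0 := posdef_invmx_gt0 b0.
set h := (_ *m b) 0 0 in h0 *.
have psd (u : 'cV[R]_n) : 0 <= (u^T *m A *m u) 0 0.
  have [->|/A_posdef/ltW //] := eqVneq u 0.
  by rewrite mulmx0 mxE.
have bw : (b^T *m w) 0 0 = 1.
  by rewrite -wb -[in RHS](trmxK b) -trmx_mul [RHS]mxE.
have := psd (w - h^-1 *: (invmx A *m b)).
rewrite [(w - _)^T]raddfB /= scaled_invmxT mulmxBl -scalemxAl mulmxKV //.
rewrite mulmxBl !mulmxBr -!scalemxAr -!scalemxAl -!mulmxA mulKVmx // !mulmxA.
rewrite [X in 0 <= X -> _](_ : _ = (w^T *m A *m w) 0 0 - h^-1) ?subr_ge0 //.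
have e (u v : 'M[R]_1) : (u - v) 0 0 = u 0 0 - v 0 0 by rewrite !mxE.
have ez c (u : 'M[R]_1) : (c *: u) 0 0 = c * u 0 0 by rewrite mxE.
by rewrite !(e, ez) wb bw -/h mulVf ?gt_eqF //; ring.
Qed.

End PositiveDefinite.

(** * The interference matrix as a function of the powers *)

Section Interference.
Variables (R : realType) (L K M : nat).
Variables (beta : 'I_L -> 'I_K -> 'I_L -> R) (p : 'M[R]_(K, L)).
Variables (Omega : 'I_L -> {set 'I_L}) (d : decoding).
Hypothesis K_lt_M : d = ZeroForcing -> (K < M)%N.
Hypothesis beta_gt0 : forall j k n, 0 < beta j k n.
Hypothesis p_gt0 : forall k n, 0 < p k n.

(** One shape for both decoders. Under zero forcing the coefficients stay nonnegative because
    [beta j m n * p m n] is a term of the sum in the denominator. *)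
Lemma lambda_affine j k :
  exists2 c : R, 0 < c & exists2 a : 'I_L -> 'I_K -> R,
    (forall n m, 0 <= a n m) &
    forall q, lambda M beta p d q j k =
      c * (1 + \sum_(n < L) \sum_(m < K) a n m * q m n).
Proof.
have s_gt0 m : 0 < 1 + \sum_(i < L) beta j m i * p m i.
  by rewrite ltr_pwDl // sumr_ge0 // => i _; rewrite ltW // mulr_gt0.
case: d K_lt_M => [_|/(_ erefl) KM].
  exists (1 + \sum_(i < L) beta j k i * p k i) => //.
  by exists (fun n m => beta j m n) => // n m; exact: ltW.
exists (M%:R / (M%:R - K%:R) * (1 + \sum_(i < L) beta j k i * p k i)).
  rewrite mulr_gt0 // divr_gt0 ?subr_gt0 ?ltr_nat // ltr0n.
  exact: leq_ltn_trans KM.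
exists (fun n m => beta j m n -
  beta j m n ^+ 2 * p m n / (1 + \sum_(i < L) beta j m i * p m i)) => // n m.
rewrite subr_ge0 ler_pdivrMr // expr2 -mulrA ler_pM2l //.
rewrite (bigD1 n) //= [1 + _]addrCA lerDl addr_ge0 // sumr_ge0 // => i _.
by rewrite ltW // mulr_gt0.
Qed.

Lemma lambda_gt0 (q : 'M[R]_(K, L)) j k :
  (forall k l, 0 <= q k l) -> 0 < lambda M beta p d q j k.
Proof.
move=> q0; have [c c0 [a a0 ->]] := lambda_affine j k.
rewrite mulr_gt0 // ltr_pwDl // sumr_ge0 // => n _.
by rewrite sumr_ge0 // => m _; rewrite mulr_ge0.
Qed.

(** Scaling the linear part by [1 + e] is enough; the subtracted [lambda] at 0 undoes the scaling of
    the constant part. *)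
Lemma lambda_ray (x y : 'M[R]_(K, L)) (e : R) j k :
  (forall k l, x k l <= (1 + e) * y k l) ->
  lambda M beta p d x j k <=
  (1 + e) * lambda M beta p d y j k - e * lambda M beta p d 0 j k.
Proof.
move=> xy; have [c c0 [a a0 lE]] := lambda_affine j k.
have S0 : \sum_(n < L) \sum_(m < K) a n m * (0 : 'M[R]_(K, L)) m n = 0.
  by rewrite big1 // => n _; rewrite big1 // => m _; rewrite mxE mulr0.
rewrite !lE S0 addr0 mulr1.
rewrite [leRHS](_ : _ = c * (1 + (1 + e) *
  \sum_(n < L) \sum_(m < K) a n m * y m n)); last by ring.
rewrite ler_pM2l // lerD2l mulr_sumr ler_sum // => n _.
by rewrite mulr_sumr ler_sum // => m _; rewrite mulrCA ler_wpM2l.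
Qed.

Variables (k : 'I_K) (l : 'I_L).

Notation A := (interference_mx M beta p Omega d k l).
Notation b := (beta_vec beta Omega l k).

Lemma interference_mx_sym (q : 'M[R]_(K, L)) : (A q)^T = A q.
Proof.
rewrite /interference_mx raddfD /= tr_diag_mx raddf_sum /=; congr (_ + _).
by apply: eq_bigr => n _; rewrite linearZ /= trmx_mul trmxK.
Qed.

(** For fixed [w] the powers enter affinely, weighted by squares, so matrix comparisons reduce to
    scalar ones. *)
Lemma interference_quadE (q : 'M[R]_(K, L)) (w : 'cV[R]_#|Omega l|) :
  (w^T *m A q *m w) 0 0 =
  \sum_(n < L | n != l) p k n * q k n * M%:R * ((b n)^T *m w) 0 0 ^+ 2 +
  \sum_(i < #|Omega l|) lambda M beta p d q (enum_val i) k * w i 0 ^+ 2.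
Proof.
rewrite /interference_mx mulmxDr mulmxDl mxE; congr (_ + _).
  rewrite mulmx_sumr mulmx_suml summxE; apply: eq_bigr => n _.
  rewrite -scalemxAr -scalemxAl mxE; congr (_ * _).
  rewrite mulmxA -(mulmxA (w^T *m b n)) mxE big_ord1 expr2; congr (_ * _).
  by rewrite -[b n]trmxK -trmx_mul mxE trmxK.
rewrite mxE; apply: eq_bigr => i _.
by rewrite mul_mx_diag !mxE expr2 mulrA [w i 0 * _]mulrC.
Qed.

Lemma interference_quad_gt0 (q : 'M[R]_(K, L)) (w : 'cV[R]_#|Omega l|) :
  (forall k l, 0 <= q k l) -> w != 0 -> 0 < (w^T *m A q *m w) 0 0.
Proof.
move=> q0 w0; rewrite interference_quadE ltr_wpDl //.
  rewrite sumr_ge0 // => n _.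
  by rewrite mulr_ge0 ?sqr_ge0 // mulr_ge0 // mulr_ge0 // ltW.
have [i wi0] : exists i, w i 0 != 0.
  apply/existsP; apply: contraNT w0; rewrite negb_exists => /forallP w0.
  by apply/eqP/colP => i; rewrite mxE; apply/eqP; have := w0 i; rewrite negbK.
rewrite (bigD1 i) //= ltr_pwDl // ?sumr_ge0 // => [|j _].
  by rewrite mulr_gt0 ?lambda_gt0 // lt0r sqrf_eq0 wi0 sqr_ge0.
by rewrite mulr_ge0 ?sqr_ge0 // ltW // lambda_gt0.
Qed.

Lemma interference_quad_ray (x y : 'M[R]_(K, L)) (e : R)
    (w : 'cV[R]_#|Omega l|) :
  (forall k l, x k l <= (1 + e) * y k l) ->
  (w^T *m A x *m w) 0 0 <=
  (1 + e) * (w^T *m A y *m w) 0 0 - e * (w^T *m A 0 *m w) 0 0.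
Proof.
move=> xy; rewrite !interference_quadE.
(* At zero power only the [lambda] part survives. *)
rewrite [X in _ - _ * (X + _)]big1 ?add0r; last first.
  by move=> n _; rewrite mxE mulr0 !mul0r.
rewrite mulrDr -addrA lerD //.
  rewrite mulr_sumr ler_sum // => n _; rewrite mulrA ler_wpM2r ?sqr_ge0 //.
  by rewrite mulrA ler_wpM2r // mulrCA ler_wpM2l // ltW.
rewrite !mulr_sumr -sumrB ler_sum // => i _.
rewrite [(1 + e) * _]mulrA [e * _]mulrA -mulrBl ler_wpM2r ?sqr_ge0 //.
exact: lambda_ray.
Qed.

End Interference.

(** * Entrywise and geometric convergence *)

Lemma cvg_mx_coord (T : topologicalType) m n (u : nat -> 'M[T]_(m, n))
    (x : 'M[T]_(m, n)) :
  (forall i j, u k i j @[k --> \oo] --> x i j) -> u @ \oo --> x.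
Proof.
move=> ux A [P Px PA]; rewrite /nbhs /=.
have : \forall k \near \oo,
    forall ij : 'I_m * 'I_n, P ij.1 ij.2 (u k ij.1 ij.2).
  by apply: filter_forall => -[i j]; exact: ux (Px i j).
by apply: filterS => k Pk; apply: PA => i j; exact: (Pk (i, j)).
Qed.

(** The telescoping series of increments converges absolutely by comparison with a geometric
    series. *)
Lemma cvg_geometric_step (R : realType) (u : nat -> R) (a z : R) :
  0 <= a -> 0 <= z < 1 -> (forall n, `|u n.+1 - u n| <= a * z ^+ n) ->
  cvgn u.
Proof.
move=> a0 /andP[z0 z1] uz.
have : cvgn (series (telescope u)).
  apply: normed_cvg.
  apply: series_le_cvg (is_cvg_geometric_series (a := a) (z := z) _).
  - by move=> n; exact: normr_ge0.
  - by move=> n; rewrite /geometric /= mulr_ge0 // exprn_ge0.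
  - exact: uz.
  - by rewrite ger0_norm.
rewrite telescopeK => su.
have -> : u = (fun n => u 0%N + (u n - u 0%N)).
  by apply/funext => n; rewrite addrC subrK.
by apply: is_cvgD => //; exact: is_cvg_cst.
Qed.

(** * Contractions of entrywise ratios on a box *)

Section ScaleContraction.
Variables (R : realType) (m n : nat).
Implicit Types x y : 'M[R]_(m, n).

(** For positive matrices this says that the Thompson metric is at most [log a]. *)
Definition scale_close (a : R) x y :=
  forall i j, x i j <= a * y i j /\ y i j <= a * x i j.

Variables (lo : 'M[R]_(m, n)) (hi : R).
Hypothesis lo_gt0 : forall i j, 0 < lo i j.

Definition in_box x := forall i j, lo i j <= x i j <= hi.

Lemma in_box_scale_close :
  exists2 e : R, 0 <= e &
    forall x y, in_box x -> in_box y -> scale_close (1 + e) x y.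
Proof.
(* The sum dominates all ratios [hi / lo i j] at once; the absolute value makes it nonnegative
   whatever the sign of [hi]. *)
pose e := \sum_i \sum_j `|hi| / lo i j.
have t0 i j : 0 <= `|hi| / lo i j by rewrite divr_ge0 // ltW.
exists e; first by rewrite sumr_ge0 // => i _; rewrite sumr_ge0.
have bnd x y i j : in_box x -> in_box y -> x i j <= (1 + e) * y i j.
  move=> /(_ i j) /andP[_ xhi] /(_ i j) /andP[loy _].
  have ij_le : `|hi| / lo i j <= 1 + e.
    rewrite /e (bigD1 i) //= (bigD1 j) //=.
    rewrite addrCA -addrA lerDl addr_ge0 ?sumr_ge0 // addr_ge0 // sumr_ge0 //.
    by move=> i' _; rewrite sumr_ge0.
  apply: (le_trans xhi); apply: (le_trans (ler_norm _)).
  rewrite -[leLHS](divfK (lt0r_neq0 (lo_gt0 i j))).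
  by rewrite ler_pM // ltW.
by move=> x y xb yb i j; split; exact: bnd.
Qed.

Lemma scale_close_dist (e : R) x y i j : 0 <= e -> in_box x -> in_box y ->
  scale_close (1 + e) x y -> `|y i j - x i j| <= e * hi.
Proof.
move=> e0 /(_ i j) /andP[_ xhi] /(_ i j) /andP[_ yhi] /(_ i j) [xy yx].
rewrite ler_norml; apply/andP; split; nra.
Qed.

Variables (T : 'M[R]_(m, n) -> 'M[R]_(m, n)) (z : R).
Hypothesis z_itv : 0 <= z < 1.
Hypothesis T_box : forall x, in_box x -> in_box (T x).
Hypothesis T_contract : forall (e : R) x y, 0 <= e -> in_box x -> in_box y ->
  scale_close (1 + e) x y -> scale_close (1 + z * e) (T x) (T y).

(** Ratios of consecutive iterates approach 1 geometrically, which in a bounded box makes the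
    increments geometric. The limit is fixed because [T] preserves closeness of ratios. *)
Lemma scale_contraction_cvg x0 : in_box x0 ->
  exists x, [/\ in_box x, T x = x & iter k T x0 @[k --> \oo] --> x].
Proof.
move=> x0b; have [z0 z1] := andP z_itv.
pose u k := iter k T x0.
have ub k : in_box (u k) by elim: k => //= k; exact: T_box.
have [e e0 eP] := in_box_scale_close.
have u_step k : scale_close (1 + z ^+ k * e) (u k) (u k.+1).
  elim: k => [|k IHk]; first by rewrite expr0 mul1r; exact: eP.
  rewrite exprS -mulrA; apply: T_contract => //; last exact: (ub k.+1).
  by rewrite mulr_ge0 // exprn_ge0.
pose x : 'M[R]_(m, n) := \matrix_(i, j) limn (fun k => u k i j).
have ux i j : u k i j @[k --> \oo] --> x i j.
  rewrite mxE; apply: (cvg_geometric_step (a := e * hi) (z := z)) => //.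
    have /andP[lhi hhi] := x0b i j.
    by rewrite mulr_ge0 // (le_trans _ hhi) // (le_trans _ lhi) // ltW.
  move=> n'; rewrite mulrAC [e * _]mulrC; apply: scale_close_dist => //.
  by rewrite mulr_ge0 // exprn_ge0.
have xb : in_box x.
  move=> i j; apply/andP; split.
    apply: cvgr_to_ge (ux i j) _; apply: nearW => k.
    by have /andP[] := ub k i j.
  apply: cvgr_to_le (ux i j) _; apply: nearW => k.
  by have /andP[] := ub k i j.
(* The positive lower bound [lo] turns entrywise convergence into closeness of ratios. *)
have close_x (e' : R) : 0 < e' ->
    \forall k \near \oo, scale_close (1 + e') (u k) x.
  move=> e'0.
  suff : \forall k \near \oo, forall ij : 'I_m * 'I_n,
      `|x ij.1 ij.2 - u k ij.1 ij.2| < e' * lo ij.1 ij.2.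
    apply: filterS => k uk i j; have := uk (i, j); rewrite /= ltr_norml.
    have /andP[lx _] := xb i j; have /andP[lu _] := ub k i j.
    by move=> /andP[? ?]; split; nra.
  apply: filter_forall => -[i j] /=.
  by have /cvgrPdist_lt := ux i j; apply; rewrite mulr_gt0.
exists x; split => //; last exact: cvg_mx_coord.
apply/matrixP => i j; apply/eqP; rewrite -subr_eq0 -normr_le0 leNgt.
apply/negP => d_gt0; have [lx hx] := andP (xb i j).
have hi_gt0 : 0 < hi by rewrite (lt_le_trans _ hx) // (lt_le_trans _ lx).
set r := `| _ | in d_gt0.
(* With this tolerance both [T x] and [x] are within [r / 4] of the iterate [u N.+1] at the entry,
   contradicting their distance [r > 0]. *)
have e'_gt0 : 0 < r / (4 * hi) by rewrite divr_gt0 // mulr_gt0.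
have [N _ NP] := close_x _ e'_gt0.
have := NP N (leqnn N) => /(T_contract (ltW e'_gt0) (ub N) xb) c1.
have c2 := NP N.+1 (leqnSn N).
have d1 := scale_close_dist i j (mulr_ge0 z0 (ltW e'_gt0)) (ub N.+1) (T_box xb) c1.
have d2 := scale_close_dist i j (ltW e'_gt0) (ub N.+1) xb c2.
have r_le : r <= `|T x i j - u N.+1 i j| + `|x i j - u N.+1 i j|.
  by rewrite /r [in leRHS](distrC (x i j)) -{1}(subrKA (u N.+1 i j)) ler_normD.
have : r / (4 * hi) * hi = r / 4 by field; exact: lt0r_neq0.
move: d1 d2; set q := r / (4 * hi) * hi => d1 d2 qE.
have : z * q <= q by rewrite ler_piMl ?qE ?divr_ge0 // ltW.
move: d1; rewrite -mulrA -/q; lra.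
Qed.

End ScaleContraction.

(** * Capped power control for an abstract interference function *)

Section CappedPowerControl.
Variables (R : realType) (m n : nat).
Implicit Types x y : 'M[R]_(m, n).

(** For positive arguments this is [min(t, c^2 / t)]: on a logarithmic scale, values above [c] are
    reflected about [c]. *)
Definition capped (c t : R) := if t <= c then t else c ^+ 2 / t.

Section Capped.
Variable c : R.
Hypothesis c_gt0 : 0 < c.

Lemma capped_gt0 t : 0 < t -> 0 < capped c t.
Proof. by rewrite /capped; case: ifP => // _ t0; rewrite divr_gt0 ?exprn_gt0. Qed.

Lemma capped_le_cap t : 0 < t -> capped c t <= c.
Proof.
rewrite /capped => t0; case: (leP t c) => // ct.
by rewrite ler_pdivrMr // expr2 ler_pM2l // ltW.
Qed.

Lemma capped_le t : 0 < t -> capped c t <= t.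
Proof.
move=> t0; have := capped_le_cap t0; rewrite /capped; case: (leP t c) => // ct h.
exact: le_trans h (ltW ct).
Qed.

Lemma capped_le_inv t : 0 < t -> capped c t <= c ^+ 2 / t.
Proof.
move=> t0; rewrite /capped; case: (leP t c) => // tc.
by rewrite ler_pdivlMr // expr2 ler_pM // ltW.
Qed.

(** Bound [capped c s] by the branch that [t] takes, whichever side of [c] holds [s]; the two
    hypotheses serve one branch each. *)
Lemma capped_scale a s t : 0 < s -> 0 < t -> s <= a * t -> t <= a * s ->
  capped c s <= a * capped c t.
Proof.
move=> s0 t0 st ts; rewrite [in leRHS]/capped; case: ifP => _.
  exact: le_trans (capped_le s0) st.
apply: le_trans (capped_le_inv s0) _.
by rewrite mulrCA ler_pM2l ?exprn_gt0 // ler_pdivlMr // mulrC ler_pdivrMr.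
Qed.

End Capped.

Variables (I : 'M[R]_(m, n) -> 'M[R]_(m, n)) (Q : R).
Hypothesis Q_gt0 : 0 < Q.
Hypothesis I_gt0 : forall x, (forall i j, 0 <= x i j) -> forall i j, 0 < I x i j.
Hypothesis I_ray : forall (e : R) x y, 0 <= e ->
  (forall i j, 0 <= x i j) -> (forall i j, 0 <= y i j) ->
  (forall i j, x i j <= (1 + e) * y i j) ->
  forall i j, I x i j <= (1 + e) * I y i j - e * I 0 i j.

Definition capped_update x := \matrix_(i, j) capped Q (I x i j).

(** The case [e = 0] of [I_ray]. *)
Lemma ray_mono x y : (forall i j, 0 <= x i j) -> (forall i j, x i j <= y i j) ->
  forall i j, I x i j <= I y i j.
Proof.
move=> x0 xy i j.
have := @I_ray 0 x y (lexx 0) x0 _ _ i j; rewrite addr0 mul1r mul0r subr0; apply.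
  by move=> i' j'; exact: le_trans (xy i' j').
by move=> i' j'; rewrite mul1r.
Qed.

Lemma capped_update_cvg (q0 : 'M[R]_(m, n)) : (forall i j, 0 < q0 i j <= Q) ->
  exists x, [/\ forall i j, 0 < x i j <= Q, capped_update x = x &
    iter k capped_update q0 @[k --> \oo] --> x].
Proof.
move=> q0b; pose top : 'M[R]_(m, n) := const_mx Q.
have top0 i j : 0 <= top i j by rewrite mxE ltW.
have z0 i j : 0 <= (0 : 'M[R]_(m, n)) i j by rewrite mxE.
(* The three terms bound from below the start, the uncapped branch and the reflected branch, so the
   box is invariant. *)
pose lo : 'M[R]_(m, n) := \matrix_(i, j)
  Num.min (q0 i j) (Num.min (I 0 i j) (Q ^+ 2 / I top i j)).
have lo_gt0 i j : 0 < lo i j.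
  rewrite mxE !lt_min I_gt0 // divr_gt0 ?exprn_gt0 ?I_gt0 // !andbT.
  by have /andP[] := q0b i j.
have box_ge0 x : in_box lo Q x -> forall i j, 0 <= x i j.
  by move=> xb i j; have /andP[lx _] := xb i j; rewrite (le_trans _ lx) // ltW.
have I_le_top x : in_box lo Q x -> forall i j, I x i j <= I top i j.
  move=> xb; apply: ray_mono; first exact: box_ge0.
  by move=> i j; rewrite mxE; have /andP[] := xb i j.
(* The least [z >= 0] with [(1 - z) I(top) <= I(0)] in every entry; the default 0 also covers empty
   matrices. *)
pose z := \big[Num.max/0]_(ij : 'I_m * 'I_n) (1 - I 0 ij.1 ij.2 / I top ij.1 ij.2).
have z_itv : 0 <= z < 1.
  rewrite bigmax_ge_id /=; apply/bigmax_ltP; split => // -[i j] _ /=.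
  by rewrite ltrBlDr ltrDl divr_gt0 // I_gt0.
have z_ge i j : (1 - z) * I top i j <= I 0 i j.
  rewrite -ler_pdivlMr ?I_gt0 // lerBlDr addrC -lerBlDr.
  exact: (le_bigmax _ (fun ij => 1 - I 0 ij.1 ij.2 / I top ij.1 ij.2) (i, j)).
have [|||x [xb Tx cvx]] := scale_contraction_cvg lo_gt0 (hi := Q)
    (T := capped_update) z_itv _ _ (x0 := q0).
- move=> x xb i j; have x0 := box_ge0 x xb.
  rewrite [capped_update x i j]mxE capped_le_cap ?I_gt0 // andbT mxE /capped.
  case: ifP => _; rewrite !ge_min.
    suff -> : I 0 i j <= I x i j by rewrite !orbT.
    by apply: ray_mono => // i' j'; rewrite mxE.
  by rewrite ler_pM2l ?exprn_gt0 // lef_pV2 ?posrE ?I_gt0 // I_le_top // !orbT.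
- move=> e x y e0 xb yb xy.
  have x0 := box_ge0 x xb; have y0 := box_ge0 y yb.
  have key u v : in_box lo Q u -> in_box lo Q v ->
      (forall i j, u i j <= (1 + e) * v i j) ->
      forall i j, I u i j <= (1 + z * e) * I v i j.
    move=> ub vb uv i j.
    have := I_ray e0 (box_ge0 u ub) (box_ge0 v vb) uv i j.
    move=> /le_trans; apply.
    (* Hence [- e I(0)] absorbs [(1 - z) e I(v)] and leaves the factor [1 + z e]. *)
    have : (1 - z) * I v i j <= I 0 i j.
      apply: le_trans (z_ge i j); rewrite ler_wpM2l ?I_le_top // subr_ge0 ltW //.
      by case/andP: z_itv.
    move=> /(ler_wpM2l e0); lra.
  have xyI := key x y xb yb (fun i j => (xy i j).1).
  have yxI := key y x yb xb (fun i j => (xy i j).2).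
  by move=> i j; rewrite !mxE; split; apply: capped_scale; rewrite ?I_gt0.
- by move=> i j; rewrite mxE ge_min lexx /=; have /andP[] := q0b i j.
exists x; split => // i j; have /andP[lx ->] := xb i j.
by rewrite (lt_le_trans _ lx).
Qed.

Lemma capped_fixed_le x y :
  (forall i j, 0 < x i j) -> capped_update x = x ->
  (forall i j, 0 < y i j) -> (forall i j, I y i j <= y i j) ->
  forall i j, x i j <= y i j.
Proof.
move=> x0 Tx y0 Iy i j; rewrite leNgt; apply/negP => yx.
pose f (ij : 'I_m * 'I_n) := x ij.1 ij.2 / y ij.1 ij.2.
case: (@arg_maxP _ _ _ (i, j) xpredT f isT) => -[i1 j1] _ fmax.
have x_le i' j' : x i' j' <= f (i1, j1) * y i' j'.
  by rewrite -ler_pdivrMr //; exact: (fmax (i', j')).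
have r1 : 1 < f (i1, j1).
  by apply: lt_le_trans (fmax (i, j) isT); rewrite /f /= ltr_pdivlMr ?mul1r.
have x0' i' j' : 0 <= x i' j' by exact: ltW.
have y0' i' j' : 0 <= y i' j' by exact: ltW.
(* Capping never increases a value, so this holds even where the cap acts. *)
have Ix : x i1 j1 <= I x i1 j1.
  by rewrite -[in leLHS]Tx mxE capped_le ?I_gt0.
have r_gt0 : 0 < f (i1, j1) - 1 by rewrite subr_gt0.
(* Taking [e = r - 1] for the maximal ratio [r] gives [x <= r I(y) - (r - 1) I(0) < r y = x] at the
   maximizing entry. *)
have := I_ray (ltW r_gt0) x0' y0' _ i1 j1; rewrite [1 + _]addrC subrK.
move=> /(_ x_le) Ixr.
have xE : x i1 j1 = f (i1, j1) * y i1 j1 by rewrite /f /= divfK // gt_eqF.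
have I0 : 0 < I 0 i1 j1 by apply: I_gt0 => i' j'; rewrite mxE.
have : f (i1, j1) * I y i1 j1 <= x i1 j1.
  by rewrite xE ler_pM2l // (lt_trans _ r1).
have : 0 < (f (i1, j1) - 1) * I 0 i1 j1 by rewrite mulr_gt0.
lra.
Qed.

(** Since [I(x) <= I(y) <= y <= Q], the cap does not act at [x]. *)
Lemma capped_fixed_feasible x y :
  (forall i j, 0 < x i j) -> capped_update x = x ->
  (forall i j, 0 < y i j <= Q) -> (forall i j, I y i j <= y i j) -> I x = x.
Proof.
move=> x0 Tx yb Iy.
have xy := capped_fixed_le x0 Tx (fun i j => proj1 (andP (yb i j))) Iy.
apply/matrixP => i j; rewrite -[in RHS]Tx mxE /capped ifT //.
apply: le_trans (ray_mono (fun i j => ltW (x0 i j)) xy i j) _.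
by apply: le_trans (Iy i j) _; have /andP[] := yb i j.
Qed.

End CappedPowerControl.

(** * The LSFD problem as capped power control *)

Section RequiredPower.
Variables (R : realType) (L K M : nat).
Variables (beta : 'I_L -> 'I_K -> 'I_L -> R) (p : 'M[R]_(K, L)).
Variables (Omega : 'I_L -> {set 'I_L}) (d : decoding) (gamma : R).
Hypothesis M_gt0 : (0 < M)%N.
Hypothesis K_lt_M : d = ZeroForcing -> (K < M)%N.
Hypothesis beta_gt0 : forall j k n, 0 < beta j k n.
Hypothesis p_gt0 : forall k n, 0 < p k n.
Hypothesis Omega_self : forall l, l \in Omega l.
Hypothesis gamma_gt0 : 0 < gamma.

Definition lsfd_gain k l (q : 'M[R]_(K, L)) : R :=
  ((beta_vec beta Omega l k l)^T *m
   invmx (interference_mx M beta p Omega d k l q) *m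
   beta_vec beta Omega l k l) 0 0.

(** The interference is frozen at [q], including the user's own power inside [lambda]; meeting the
    target exactly is thus a fixed-point equation in [q]. *)
Definition required_power (q : 'M[R]_(K, L)) : 'M[R]_(K, L) :=
  \matrix_(k, l) (gamma / (p k l * M%:R) / lsfd_gain k l q).

Lemma beta_vec_neq0 k l n : beta_vec beta Omega l k n != 0.
Proof.
apply/eqP => /colP /(_ (enum_rank_in (Omega_self l) l)).
by rewrite !mxE; apply/eqP; rewrite gt_eqF.
Qed.

Lemma lsfd_gain_gt0 k l (q : 'M[R]_(K, L)) :
  (forall k l, 0 <= q k l) -> 0 < lsfd_gain k l q.
Proof.
move=> q0; apply: posdef_invmx_gt0; last exact: beta_vec_neq0.
  exact: interference_mx_sym.
by move=> w; exact: interference_quad_gt0.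
Qed.

Let price_gt0 k l : 0 < gamma / (p k l * M%:R).
Proof. by rewrite divr_gt0 // mulr_gt0 ?ltr0n. Qed.

Lemma required_power_gt0 (q : 'M[R]_(K, L)) : (forall k l, 0 <= q k l) ->
  forall k l, 0 < required_power q k l.
Proof. by move=> q0 k l; rewrite mxE divr_gt0 // lsfd_gain_gt0. Qed.

Lemma required_power_ray (e : R) (x y : 'M[R]_(K, L)) : 0 <= e ->
  (forall k l, 0 <= x k l) -> (forall k l, 0 <= y k l) ->
  (forall k l, x k l <= (1 + e) * y k l) ->
  forall k l, required_power x k l <=
    (1 + e) * required_power y k l - e * required_power 0 k l.
Proof.
move=> e0 x0 y0 xy k l.
have sym q := interference_mx_sym M beta p Omega d k l q.
have pd (q : 'M[R]_(K, L)) q0 w :=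
  @interference_quad_gt0 R L K M beta p Omega d K_lt_M beta_gt0 p_gt0 k l q w q0.
have b0 := beta_vec_neq0 k l l.
have z0 k' l' : 0 <= (0 : 'M[R]_(K, L)) k' l' by rewrite mxE.
(* The minimizer for [y] serves as trial vector at [x] and at 0; the bound at 0 enters with a minus
   sign, in the right direction. *)
have [w wb wy] := posdef_quad_attained (sym y) (pd y y0) b0.
have wx := posdef_quad_ge (sym x) (pd x x0) b0 wb.
have w0 := posdef_quad_ge (sym 0) (pd 0 z0) b0 wb.
have ray := @interference_quad_ray R L K M beta p Omega d
  K_lt_M beta_gt0 p_gt0 k l x y e w xy.
rewrite wy in ray; rewrite !mxE ![_ * (_ / _ / _)]mulrCA -mulrBr ler_pM2l //.
apply: le_trans wx _; apply: le_trans ray _.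
by rewrite lerD2l lerN2 ler_wpM2l.
Qed.

Lemma SINR_decE k l (q : 'M[R]_(K, L)) : (forall k l, 0 < q k l) ->
  SINR_dec M beta p Omega d k l q = q k l * gamma / required_power q k l.
Proof.
move=> q0; have g0 := lsfd_gain_gt0 k l (fun k l => ltW (q0 k l)).
rewrite /SINR_dec -/(lsfd_gain k l q) mxE; field.
by rewrite !gt_eqF ?ltr0n.
Qed.

Variable Qmax : R.

(** Positive powers make every quotient genuine, and [q / SINR] becomes [I(q) / gamma]. *)
Lemma power_updateE (q : 'M[R]_(K, L)) : (forall k l, 0 < q k l) ->
  power_update M beta p Omega d gamma Qmax q = capped_update required_power Qmax q.
Proof.
move=> q0; apply/matrixP => k l.
have I0 := required_power_gt0 (fun k l => ltW (q0 k l)) k l.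
rewrite [LHS]mxE [RHS]mxE /capped SINR_decE //.
have -> : q k l / (q k l * gamma / required_power q k l) =
    required_power q k l / gamma by field; rewrite !gt_eqF.
rewrite ler_pM2r ?invr_gt0 //; case: ifP => _; field; rewrite !gt_eqF //.
Qed.

Lemma feasible_powerE (q : 'M[R]_(K, L)) :
  feasible_power M beta p Omega d gamma Qmax q <->
  (forall k l, 0 < q k l <= Qmax) /\ (forall k l, required_power q k l <= q k l).
Proof.
have SINR_ge (q' : 'M[R]_(K, L)) k l : (forall k l, 0 < q' k l) ->
    (gamma <= SINR_dec M beta p Omega d k l q') = (required_power q' k l <= q' k l).
  move=> q0; have I0 := required_power_gt0 (fun k l => ltW (q0 k l)) k l.
  by rewrite SINR_decE // ler_pdivlMr // mulrC ler_pM2r.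
split=> [qf|[qb Iq] k l].
  (* A zero power would give SINR 0, below the target. *)
  have q0 k l : 0 < q k l.
    have [/andP[q0 _] SINR_q] := qf k l.
    rewrite lt0r q0 andbT; apply/eqP => qkl0; move: SINR_q.
    by rewrite /SINR_dec qkl0 mulr0 !mul0r leNgt gamma_gt0.
  split=> k l; have [/andP[_ qQ] SINR_q] := qf k l; first by rewrite q0.
  by rewrite -SINR_ge.
have q0 k' l' : 0 < q k' l' by have /andP[] := qb k' l'.
by have /andP[/ltW-> ->] := qb k l; rewrite SINR_ge.
Qed.

End RequiredPower.

Theorem theorem7 (R : realType) (L K M L' : nat)
    (beta : 'I_L -> 'I_K -> 'I_L -> R) (p : 'M[R]_(K, L))
    (Omega : 'I_L -> {set 'I_L}) (d : decoding) (gamma Qmax : R)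
    (q0 : 'M[R]_(K, L))
    (HM : (0 < M)%N)
    (HZF : d = ZeroForcing -> (K < M)%N)
    (Hbeta : forall j k n, 0 < beta j k n)
    (Hp : forall k n, 0 < p k n)
    (HOmega : forall l, l \in Omega l)
    (HcardOmega : forall l, #|Omega l| = L'.+1)
    (Hgamma : 0 < gamma) (HQmax : 0 < Qmax)
    (Hq0 : forall k l, 0 < q0 k l <= Qmax) :
  let q := power_seq M beta p Omega d gamma Qmax q0 in
  (exists qlim : 'M[R]_(K, L), q @ \oo --> qlim) /\
  ((exists qf : 'M[R]_(K, L),
      feasible_power M beta p Omega d gamma Qmax qf) ->
   exists2 qopt : 'M[R]_(K, L),
     unique (optimal_power M beta p Omega d gamma Qmax) qopt &
     q @ \oo --> qopt).
Proof.
move=> q.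
pose I := required_power M beta p Omega d gamma.
have I_gt0 := required_power_gt0 (d := d) HM HZF Hbeta Hp HOmega Hgamma.
have I_ray := required_power_ray (d := d) HM HZF Hbeta Hp HOmega Hgamma.
have feasE := feasible_powerE (d := d) HM HZF Hbeta Hp HOmega Hgamma Qmax.
(* Positivity is carried through the induction because identifying the two updates requires it. *)
have qE n : q n = iter n (capped_update I Qmax) q0 /\ forall k l, 0 < q n k l.
  elim: n => [|n [IHn qn0]].
    by split => // k l; have /andP[] := Hq0 k l.
  have qS : q n.+1 = capped_update I Qmax (q n) by exact: power_updateE.
  split; first by rewrite qS IHn.
  by move=> k l; rewrite qS mxE capped_gt0 // I_gt0 // => k' l'; exact: ltW.
have [x [xb Tx]] := capped_update_cvg HQmax I_gt0 I_ray Hq0.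
have -> : (fun n => iter n (capped_update I Qmax) q0) = q.
  by apply/funext => n; have [-> _] := qE n.
move=> cvx; split; first by exists x.
move=> [y /feasE[yb Iy]].
have x_gt0 k l : 0 < x k l by have /andP[] := xb k l.
exists x => //.
have Ix := capped_fixed_feasible HQmax I_gt0 I_ray x_gt0 Tx yb Iy.
have x_min z : feasible_power M beta p Omega d gamma Qmax z ->
    forall k l, x k l <= z k l.
  move=> /feasE[zb Iz]; apply: capped_fixed_le I_gt0 I_ray _ _ x_gt0 Tx _ Iz => //.
  by move=> k l; have /andP[] := zb k l.
have x_feas : feasible_power M beta p Omega d gamma Qmax x.
  by apply/feasE; split => // k l; rewrite Ix.
split.
  split => // z /x_min xz.
  by apply: ler_sum => k _; apply: ler_sum => l _.
(* Uniqueness: another optimum dominates [x] entrywise with the same total, so the nonnegative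
   differences all vanish. *)
move=> z [z_feas z_min]; have xz := x_min z z_feas.
have : total_power z = total_power x.
  apply/eqP; rewrite eq_le z_min //=.
  by apply: ler_sum => k _; apply: ler_sum => l _.
move=> /eqP; rewrite -subr_eq0 /total_power -sumrB.
under eq_bigr do rewrite -sumrB.
rewrite psumr_eq0 => [|k _]; last by rewrite sumr_ge0 // => l _; rewrite subr_ge0.
move=> /allP zx; apply/matrixP => k l.
have := zx k (mem_index_enum k); rewrite psumr_eq0 => [|l' _]; last by rewrite subr_ge0.
by move=> /allP /(_ l (mem_index_enum l)); rewrite subr_eq0 => /eqP.
Qed.
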